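(* Let $m,n\ge 0$ be integers, let $\lambda$ be an $(m|n)$-hook partition, and let $\mu=(\mu_a)_{a\in A}$ be a content, i.e. a family of non-negative integers indexed by $A=\{1,\dots,m,\bar 1,\dots,\bar n\}$ with $\sum_{a\in A}\mu_a=|\lambda|$. For an $\epsilon$-$\delta$ sequence $\mathfrak{b}$ for $\mathfrak{gl}(m|n)$, let $K^{\mathfrak{b}}_{\lambda,\mu}$ be the number of $\mathfrak{b}$-semistandard tableaux of shape $\lambda$ and content $\mu$. Then $K^{\mathfrak{b}}_{\lambda,\mu}$ is independent of the choice of $\mathfrak{b}$; that is, $K^{\mathfrak{b}}_{\lambda,\mu}=K^{\mathfrak{b}'}_{\lambda,\mu}$ for any two $\epsilon$-$\delta$ sequences $\mathfrak{b},\mathfrak{b}'$ for $\mathfrak{gl}(m|n)$. In particular, there is a well-defined number $K^{(m|n)}_{\lambda,\mu}=K^{\mathfrak{b}}_{\lambda,\mu}$.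
   Context: Partitions $\lambda=(\lambda_1\ge\lambda_2\ge\cdots)$ are identified with their Young diagrams, and $|\lambda|=\sum_i\lambda_i$. $\lambda$ is an $(m|n)$-hook partition if $\lambda_{m+1}\le n$. An $\epsilon$-$\delta$ sequence for $\mathfrak{gl}(m|n)$ is a sequence consisting of $m$ symbols $\delta$ and $n$ symbols $\epsilon$ in some order (these sequences index the conjugacy classes of Borel subalgebras of the Lie superalgebra $\mathfrak{gl}(m|n)$). Given such a sequence $\mathfrak{b}$, let $<_{\mathfrak{b}}$ be the total order on $A=\{1,\dots,m,\bar 1,\dots,\bar n\}$ obtained by letting $i$ correspond to the $i$-th $\delta$ of $\mathfrak{b}$ and $\bar j$ to the $j$-th $\epsilon$ of $\mathfrak{b}$, and ordering letters by their positions in $\mathfrak{b}$ (earlier position means smaller). A $\mathfrak{b}$-semistandard tableau of shape $\lambda$ is a filling of the boxes of the Young diagram of $\lambda$ with entries in $A$ such that: (1) entries are weakly increasing along each row (left to right) and each column (top to bottom) with respect to $<_{\mathfrak{b}}$; (2) entries from $\{1,\dots,m\}$ are strictly increasing along each column; (3) entries from $\{\bar 1,\dots,\bar n\}$ are strictly increasing along each row. Such a tableau has content $\mu$ if each letter $a\in A$ appears in exactly $\mu_a$ boxes. *)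

(* Defs.v *)
From HB Require Import structures.
From mathcomp Require Import all_boot.

Set Implicit Arguments.
Unset Strict Implicit.
Unset Printing Implicit Defensive.

(* Parts are positive, so each partition has exactly one representation; the
   part lambda_(i+1) is [nth 0 la i], which is 0 past the end of the list. *)
Definition is_partition (la : seq nat) : bool :=
  sorted geq la && (0 \notin la).

Definition is_hook_partition (m n : nat) (la : seq nat) : bool :=
  is_partition la && (nth 0 la m <= n).

Inductive symbol := delta | epsilon.

Definition symbol_to_bool (s : symbol) : bool :=
  if s is delta then true else false.
Definition bool_to_symbol (c : bool) : symbol :=
  if c then delta else epsilon.
Lemma symbol_to_boolK : cancel symbol_to_bool bool_to_symbol.
Proof. by case. Qed.
HB.instance Definition _ := Equality.copy symbol (can_type symbol_to_boolK).

Definition is_eps_delta_seq (m n : nat) (b : seq symbol) : bool :=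
  (count_mem delta b == m) && (count_mem epsilon b == n).

(* [inl i] is the letter i+1 and [inr j] is the letter bar(j+1). *)
Definition letter (m n : nat) : finType := ('I_m + 'I_n)%type.

Definition is_unbarred m n (a : letter m n) : bool :=
  if a is inl _ then true else false.

Definition is_barred m n (a : letter m n) : bool := ~~ is_unbarred a.

Definition positions (s : symbol) (b : seq symbol) : seq nat :=
  [seq p <- iota 0 (size b) | nth delta b p == s].

(* The default value [size b] is never reached when b is an epsilon-delta
   sequence for gl(m|n); in that case [letter_pos b] is injective, so that
   [letter_le b] is a total order with strict part [letter_lt b]. *)
Definition letter_pos m n (b : seq symbol) (a : letter m n) : nat :=
  match a with
  | inl i => nth (size b) (positions delta b) i
  | inr j => nth (size b) (positions epsilon b) j
  end.

Definition letter_le m n (b : seq symbol) (a a' : letter m n) : bool :=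
  letter_pos b a <= letter_pos b a'.

Definition letter_lt m n (b : seq symbol) (a a' : letter m n) : bool :=
  letter_pos b a < letter_pos b a'.

Definition box (la : seq nat) : finType :=
  {i : 'I_(size la) & 'I_(nth 0 la i)}.

Definition row_of la (x : box la) : nat := tag x.
Definition col_of la (x : box la) : nat := tagged x.

Definition left_of la (x y : box la) : bool :=
  (row_of x == row_of y) && (col_of x < col_of y).

Definition above la (x y : box la) : bool :=
  (col_of x == col_of y) && (row_of x < row_of y).

Definition filling (m n : nat) (la : seq nat) : finType :=
  {ffun box la -> letter m n}.

Definition is_semistandard m n (b : seq symbol) la
    (T : filling m n la) : bool :=
  [&& [forall x, forall y, left_of x y ==> letter_le b (T x) (T y)],
      [forall x, forall y, above x y ==> letter_le b (T x) (T y)],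
      [forall x, forall y,
        [&& above x y, is_unbarred (T x) & is_unbarred (T y)]
          ==> letter_lt b (T x) (T y)]
    & [forall x, forall y,
        [&& left_of x y, is_barred (T x) & is_barred (T y)]
          ==> letter_lt b (T x) (T y)]].

Definition has_content m n la (T : filling m n la)
    (mu : letter m n -> nat) : bool :=
  [forall a, #|[set x | T x == a]| == mu a].

Definition super_kostka m n (b : seq symbol) (la : seq nat)
    (mu : letter m n -> nat) : nat :=
  #|[set T : filling m n la | is_semistandard b T && has_content T mu]|.

(* Main.v *)
Require Import Defs.
From mathcomp Require Import all_boot zify.

Set Implicit Arguments.
Unset Strict Implicit.
Unset Printing Implicit Defensive.

(** Any two sequences are related by swaps of adjacent symbols, so let two
    letters, [a] unbarred and [e] barred, be adjacent in the order. In a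
    semistandard tableau the boxes holding [a] or [e] form a skew shape without
    2x2 square, so this shape has at most one box on each diagonal, and its
    connected components are ribbons. If [a < e], then along a ribbon, read from
    its south-west end, each box holds [a] or [e] according to whether the next
    box is to its right or above it, and the last box is free. If [e < a], each
    box is determined in the same way by the previous box, and the first one is
    free. Moving every entry to the next box, and the entries of the last boxes
    to the first boxes, is thus an injection that preserves contents.
    Transposition exchanges the roles of [a] and [e], which gives the opposite
    inequality. *)

(** * Extending a partial injection of a finite set to a permutation *)

Section Extension.
Variable B : finType.
Variables (A : {set B}) (f : B -> B).

(** The complement of [A] is matched by rank with the complement of the image of [A]. When [f] is
    injective on [A] both have the same size, so the default [x] is never reached. *)
Definition extend_inj (x : B) : B :=
  if x \in A then f x
  else nth x (enum (~: (f @: A))) (index x (enum (~: A))).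

Lemma extend_inj_in x : x \in A -> extend_inj x = f x.
Proof. by rewrite /extend_inj => ->. Qed.

Hypothesis injf : {in A &, injective f}.

Let size_enumC : size (enum (~: (f @: A))) = size (enum (~: A)).
Proof. by rewrite -!cardE [LHS]cardsCs [RHS]cardsCs !setCK card_in_imset. Qed.

Let index_lt x : x \notin A ->
  index x (enum (~: A)) < size (enum (~: (f @: A))).
Proof. by move=> xA; rewrite size_enumC index_mem mem_enum inE. Qed.

Let extend_inj_out x : x \notin A -> extend_inj x \notin f @: A.
Proof.
move=> xA; rewrite /extend_inj (negbTE xA).
by have := mem_nth x (index_lt xA); rewrite mem_enum inE.
Qed.

Lemma extend_inj_inj : injective extend_inj.
Proof.
move=> x y; have [xA|xA] := boolP (x \in A); have [yA|yA] := boolP (y \in A).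
- by rewrite !extend_inj_in //; exact: injf.
- move=> exy; have := extend_inj_out yA.
  by rewrite -exy extend_inj_in // imset_f.
- move=> exy; have := extend_inj_out xA.
  by rewrite exy extend_inj_in // imset_f.
rewrite /extend_inj (negbTE xA) (negbTE yA).
rewrite (set_nth_default x y) ?index_lt // => /eqP.
rewrite nth_uniq ?enum_uniq ?index_lt // => /eqP exy.
have xC : x \in enum (~: A) by rewrite mem_enum inE.
have yC : y \in enum (~: A) by rewrite mem_enum inE.
by rewrite -(nth_index x xC) exy nth_index.
Qed.

End Extension.

(** * Tableaux on an abstract set of boxes with row and column maps *)

Section Tableaux.
Variables (B L : finType).
Implicit Types (r c : B -> nat) (T : {ffun B -> L}) (pos : L -> nat).

Definition increasing_lines r c (strict : pred L) pos T :=
  [forall x, forall y, (r x == r y) && (c x < c y) ==>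
     (pos (T x) <= pos (T y)) &&
     (strict (T x) && strict (T y) ==> (pos (T x) < pos (T y)))].

Lemma increasing_linesP r c (strict : pred L) pos T :
  reflect (forall x y, r x = r y -> c x < c y ->
             pos (T x) <= pos (T y) /\
             (strict (T x) -> strict (T y) -> pos (T x) < pos (T y)))
          (increasing_lines r c strict pos T).
Proof.
apply: (iffP 'forall_forallP) => H x y.
  move=> rxy cxy; have := H x y; rewrite rxy eqxx cxy /=.
  by case/andP=> -> /implyP lt; split=> // sx sy; apply: lt; rewrite sx.
apply/implyP => /andP[/eqP rxy cxy]; have [-> lt] := H x y rxy cxy.
by apply/implyP => /andP[]; exact: lt.
Qed.

(* The predicates [bar] and [unb] are kept independent, so that transposition
   just exchanges [r] with [c] and [bar] with [unb]. *)
Definition semistandard r c (bar unb : pred L) pos T :=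
  increasing_lines r c bar pos T && increasing_lines c r unb pos T.

Lemma semistandard_tr r c (bar unb : pred L) pos T :
  semistandard c r unb bar pos T = semistandard r c bar unb pos T.
Proof. exact: andbC. Qed.

Definition content_eq (mu : L -> nat) T :=
  [forall l, #|[set x | T x == l]| == mu l].

(** An injection of the finite type [B] into itself is a permutation, so it preserves the sizes of
    fibres. *)
Lemma content_eq_comp (mu : L -> nat) T (s : B -> B) : injective s ->
  content_eq mu [ffun x => T (s x)] = content_eq mu T.
Proof.
move=> injs; apply: eq_forallb => l; congr (_ == _).
rewrite -(card_preimset [set x | T x == l] injs).
by apply: eq_card => x; rewrite !inE ffunE.
Qed.

(** Order-convexity, the property characterising skew shapes. *)
Definition convex_shape r c := forall x y i j,
  r x <= i <= r y -> c x <= j <= c y -> exists z, r z = i /\ c z = j.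

Lemma convex_shape_tr r c : convex_shape r c -> convex_shape c r.
Proof.
by move=> cv x y i j ci rj; have [z [? ?]] := cv x y j i rj ci; exists z.
Qed.

(** * Ribbons and the exchange of two adjacent letters *)

Section Swap.
Variables (r c : B -> nat) (bar unb : pred L) (pos pos' : L -> nat).
Variables (a e : L).
Implicit Types (D : {set B}) (l : L).

Hypothesis rc_inj : forall x y, r x = r y -> c x = c y -> x = y.
Hypothesis cv : convex_shape r c.
Hypothesis pos_inj : injective pos.
Hypotheses (unb_a : unb a) (bar_a : ~~ bar a) (bar_e : bar e) (unb_e : ~~ unb
  e).
Hypothesis pos_e : pos e = (pos a).+1.
Hypotheses (pos'_a : pos' a = pos e) (pos'_e : pos' e = pos a).
Hypothesis pos'_id : forall l, l != a -> l != e -> pos' l = pos l.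

Definition is_ae : pred L := pred2 a e.

Definition ae_boxes T : {set B} := [set x | is_ae (T x)].

(* The diagonal of [y], numbered by [c - r], precedes the one of [x]. *)
Definition diag_pred (x y : B) := c x + r y == (c y + r x).+1.

(** On a rim, a box on the preceding diagonal is the left or lower neighbour of [x]: any other would
    be strictly north-west or south-east of [x]. *)
Definition prev_box D x :=
  if x \in D then odflt x [pick y in D | diag_pred x y] else x.

(** Omits only the first boxes of the ribbons. Boxes outside [D] are kept, so that the extension
    must fix them. *)
Definition prev_dom D : {set B} :=
  [set x | (x \in D) ==> [exists y in D, diag_pred x y]].

(** For a convex set this means that it contains no 2x2 square. *)
Definition rim D :=
  forall x y, x \in D -> y \in D -> r x < r y -> c x < c y -> False.

Lemma rim_diag D x y : rim D -> x \in D -> y \in D ->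
  c x + r y = c y + r x -> x = y.
Proof.
move=> rimD xD yD exy; have [lt|lt|eqr] := ltngtP (r x) (r y).
- by case: (rimD x y) => //; lia.
- by case: (rimD y x) => //; lia.
- by apply: rc_inj => //; lia.
Qed.

Lemma prev_box_eq D x y : rim D -> x \in D -> y \in D -> diag_pred x y ->
  prev_box D x = y.
Proof.
move=> rimD xD yD xy; rewrite /prev_box xD; case: pickP => [z /andP[zD]|/(_ y)].
  by move: xy; rewrite /diag_pred => /eqP ? /eqP ? /=;
    apply: (rim_diag rimD) => //; lia.
by rewrite yD xy.
Qed.

(** Inside [D] the map goes down by one diagonal and [D] has at most one box on each; outside [D] it
    is the identity. *)
Lemma prev_box_inj D : rim D -> {in prev_dom D &, injective (prev_box D)}.
Proof.
move=> rimD x y; rewrite !inE.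
have [xD /= /exists_inP[x' x'D xx']|xD _] := boolP (x \in D);
  have [yD /= /exists_inP[y' y'D yy']|yD _] := boolP (y \in D).
- rewrite (prev_box_eq rimD xD x'D xx') (prev_box_eq rimD yD y'D yy') => exy.
  move: xx' yy'; rewrite /diag_pred exy => /eqP ? /eqP ?.
  by apply: (rim_diag rimD) => //; lia.
- rewrite (prev_box_eq rimD xD x'D xx') /prev_box (negbTE yD) => exy.
  by move: yD; rewrite -exy x'D.
- rewrite (prev_box_eq rimD yD y'D yy') /prev_box (negbTE xD) => exy.
  by move: xD; rewrite exy y'D.
- by rewrite /prev_box (negbTE xD) (negbTE yD).
Qed.

(* Which last box of a ribbon is sent to which first box is irrelevant, so any
   bijective extension will do. *)
Definition shift_box D := extend_inj (prev_dom D) (prev_box D).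

Definition shift T : {ffun B -> L} := [ffun x => T (shift_box (ae_boxes T) x)].

Lemma shift_box_inj D : rim D -> injective (shift_box D).
Proof. by move=> rimD; apply: extend_inj_inj; exact: prev_box_inj. Qed.

Lemma shift_box_id D x : x \notin D -> shift_box D x = x.
Proof.
move=> xD; rewrite /shift_box extend_inj_in /prev_box ?(negbTE xD) //.
by rewrite inE (negbTE xD).
Qed.

Lemma shift_box_eq D x y : rim D -> x \in D -> y \in D -> diag_pred x y ->
  shift_box D x = y.
Proof.
move=> rimD xD yD xy; rewrite /shift_box extend_inj_in ?(prev_box_eq _ _ yD) //.
by rewrite inE xD; apply/exists_inP; exists y.
Qed.

Lemma mem_shift_box D x : rim D -> (shift_box D x \in D) = (x \in D).
Proof.
move=> rimD; have [xD|xD] := boolP (x \in D); last first.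
  by rewrite shift_box_id // (negbTE xD).
(* A value outside [D] is itself fixed by [shift_box], hence equals [x] by injectivity. *)
apply: contraLR (xD) => sxD.
by have /(shift_box_inj rimD) <- := shift_box_id sxD.
Qed.

Lemma ae_boxes_shift T : rim (ae_boxes T) -> ae_boxes (shift T) = ae_boxes T.
Proof.
move=> rimT; apply/setP => x; rewrite -[RHS](mem_shift_box x rimT).
by rewrite !inE ffunE.
Qed.

Lemma ae_eq_a l : is_ae l -> l != e -> l = a.
Proof. by case/orP=> /eqP -> //; rewrite eqxx. Qed.

Lemma ae_eq_e l : is_ae l -> l != a -> l = e.
Proof. by case/orP=> /eqP -> //; rewrite eqxx. Qed.

(** The positions of [a] and [e] are consecutive, so no third letter fits between them. *)
Lemma ae_between l1 l l2 : is_ae l1 -> is_ae l2 ->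
  pos l1 <= pos l -> pos l <= pos l2 -> is_ae l.
Proof.
move=> h1 h2 le1 le2.
have ge : pos a <= pos l.
  by apply: leq_trans le1; case/orP: h1 => /eqP ->; rewrite ?pos_e.
have le : pos l <= (pos a).+1.
  by apply: leq_trans le2 _; case/orP: h2 => /eqP ->; rewrite ?pos_e.
have [/eqP eqa|ne] := boolP (pos l == pos a).
  by rewrite (pos_inj eqa) /is_ae /= eqxx.
have eqe : pos l = pos e by rewrite pos_e; lia.
by rewrite (pos_inj eqe) /is_ae /= eqxx orbT.
Qed.

(** * The shift of a single tableau *)

Section OneTableau.
Variable T : {ffun B -> L}.
Hypothesis sT : semistandard r c bar unb pos T.

Let row x y : r x = r y -> c x < c y -> pos (T x) <= pos (T y) /\
  (bar (T x) -> bar (T y) -> pos (T x) < pos (T y)).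
Proof. by case/andP: sT => /increasing_linesP H _; exact: H. Qed.

Let col x y : c x = c y -> r x < r y -> pos (T x) <= pos (T y) /\
  (unb (T x) -> unb (T y) -> pos (T x) < pos (T y)).
Proof. by case/andP: sT => _ /increasing_linesP H; exact: H. Qed.

(** An [e] at [x] would force an [e] at [y], but a barred letter cannot repeat in a row. *)
Lemma ae_row x y : x \in ae_boxes T -> y \in ae_boxes T ->
  r x = r y -> c x < c y -> T x = a.
Proof.
rewrite !inE => xae yae rxy cxy; have [le lt] := row rxy cxy.
apply: (ae_eq_a xae); apply/eqP => ex.
have ey : T y = e by apply: (ae_eq_e yae); apply/eqP => ey;
  rewrite ex ey in le; lia.
by move: lt; rewrite ex ey bar_e ltnn => /(_ isT isT).
Qed.

Lemma ae_col x y : x \in ae_boxes T -> y \in ae_boxes T ->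
  c x = c y -> r x < r y -> T y = e.
Proof.
rewrite !inE => xae yae cxy rxy; have [le lt] := col cxy rxy.
apply: (ae_eq_e yae); apply/eqP => ey.
have ex : T x = a by apply: (ae_eq_a xae); apply/eqP => ex;
  rewrite ex ey in le; lia.
by move: lt; rewrite ex ey unb_a ltnn => /(_ isT isT).
Qed.

Lemma pos_box_mono x y : r x <= r y -> c x <= c y -> pos (T x) <= pos (T y).
Proof.
(* [z] is the north-east corner: go along the row of [x], then down the column of [y]. *)
move=> rxy cxy; have [z [rz cz]] : exists z, r z = r x /\ c z = c y.
  by apply: (cv (x := x) (y := y)); lia.
apply: (@leq_trans (pos (T z))).
  have [eqc|ne] := eqVneq (c x) (c z); first by rewrite (rc_inj (esym rz) eqc).
  by have [] := @row x z (esym rz); lia.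
have [eqr|ne] := eqVneq (r z) (r y); first by rewrite (rc_inj eqr cz).
by have [] := @col z y cz; lia.
Qed.

Lemma ae_boxes_convex x y i j : x \in ae_boxes T -> y \in ae_boxes T ->
  r x <= i <= r y -> c x <= j <= c y ->
  exists z, [/\ z \in ae_boxes T, r z = i & c z = j].
Proof.
move=> xae yae hi hj; have [z [rz cz]] := cv hi hj; exists z; split=> //.
move: xae yae; rewrite !inE => xae yae.
by apply: (ae_between xae yae); apply: pos_box_mono; lia.
Qed.

(** The south-west corner of the rectangle spanned by [x] and [y] would hold [e], being below [x],
    and also [a], being left of [y]. *)
Lemma rim_ae_boxes : rim (ae_boxes T).
Proof.
move=> x y xD yD rxy cxy.
have [z [zD rz cz]] : exists z, [/\ z \in ae_boxes T, r z = r y & c z = c x].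
  by apply: (ae_boxes_convex xD yD); lia.
have ze : T z = e by apply: (ae_col xD zD); lia.
have za : T z = a by apply: (ae_row zD yD); lia.
by move: unb_a; rewrite -za ze (negbTE unb_e).
Qed.

(** By convexity the predecessor of [y] is its left neighbour, which holds [a] because [y] follows
    it in the row. *)
Lemma shift_row x y : x \in ae_boxes T -> y \in ae_boxes T ->
  r x = r y -> c x < c y -> shift T y = a.
Proof.
move=> xD yD rxy cxy.
have [z [zD rz cz]] : exists z, [/\
  z \in ae_boxes T, r z = r y & c z = (c y).-1].
  by apply: (ae_boxes_convex xD yD); lia.
rewrite ffunE (shift_box_eq rim_ae_boxes yD zD); last by rewrite /diag_pred;
  lia.
by apply: (ae_row zD yD); lia.
Qed.

(** The predecessor of [x] is the box below it, which holds [e] because [x] lies above. *)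
Lemma shift_col x y : x \in ae_boxes T -> y \in ae_boxes T ->
  c x = c y -> r x < r y -> shift T x = e.
Proof.
move=> xD yD cxy rxy.
have [z [zD rz cz]] : exists z, [/\
  z \in ae_boxes T, r z = (r x).+1 & c z = c x].
  by apply: (ae_boxes_convex xD yD); lia.
rewrite ffunE (shift_box_eq rim_ae_boxes xD zD); last by rewrite /diag_pred;
  lia.
by apply: (ae_col xD zD); lia.
Qed.

Lemma shift_id x : x \notin ae_boxes T -> shift T x = T x.
Proof. by move=> xD; rewrite ffunE shift_box_id. Qed.

Lemma mem_shift x : (x \in ae_boxes T) = is_ae (shift T x).
Proof. by rewrite -[in LHS](ae_boxes_shift rim_ae_boxes) inE. Qed.

Lemma pos'_shift_out x : x \notin ae_boxes T -> pos' (shift T x) = pos (T x).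
Proof.
move=> xD; rewrite shift_id //; move: xD; rewrite inE negb_or => /andP[*].
exact: pos'_id.
Qed.

Lemma pos_out x : x \notin ae_boxes T ->
  pos (T x) != pos a /\ pos (T x) != pos e.
Proof. by rewrite !(inj_eq pos_inj) inE negb_or => /andP[]. Qed.

Lemma pos_in x : x \in ae_boxes T -> pos a <= pos (T x) <= pos e.
Proof. by rewrite inE => /orP[] /eqP ->; rewrite pos_e leqnSn leqnn. Qed.

Lemma pos'_shift_in x : x \in ae_boxes T -> pos a <= pos' (shift T x) <= pos e.
Proof.
by rewrite mem_shift => /orP[] /eqP ->;
  rewrite ?pos'_a ?pos'_e pos_e leqnSn leqnn.
Qed.

(** Together [a] and [e] occupy the same two consecutive positions in both orders, so any other
    letter compares with both in the same way, and strictly. *)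
Lemma shift_out (strict : pred L) x y :
  ~~ ((x \in ae_boxes T) && (y \in ae_boxes T)) ->
  pos (T x) <= pos (T y) /\
    (strict (T x) -> strict (T y) -> pos (T x) < pos (T y)) ->
  pos' (shift T x) <= pos' (shift T y) /\
    (strict (shift T x) -> strict (shift T y) ->
     pos' (shift T x) < pos' (shift T y)).
Proof.
move=> out [le lt].
have [xD|xD] := boolP (x \in ae_boxes T); last first.
  have [yD|yD] := boolP (y \in ae_boxes T);
    last by rewrite !pos'_shift_out // !shift_id.
  suff lt' : pos' (shift T x) < pos' (shift T y) by split=> //; exact: ltnW.
  rewrite pos'_shift_out //; have [? ?] := pos_out xD.
  by have := pos_in yD; have := pos'_shift_in yD; lia.
have yD : y \notin ae_boxes T by rewrite xD in out.
suff lt' : pos' (shift T x) < pos' (shift T y) by split=> //; exact: ltnW.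
rewrite (pos'_shift_out yD); have [? ?] := pos_out yD.
by have := pos_in xD; have := pos'_shift_in xD; lia.
Qed.

Lemma shift_semistandard : semistandard r c bar unb pos' (shift T).
Proof.
apply/andP; split; apply/increasing_linesP => x y.
  move=> rxy cxy.
  have [/andP[xD yD]|] := boolP ((x \in ae_boxes T) && (y \in ae_boxes T)).
    (* The right-hand box holds [a], now the larger of the two letters and allowed to repeat in
       rows. *)
    rewrite (shift_row xD yD rxy cxy) (negbTE bar_a) pos'_a.
    by have /andP[_ ->] := pos'_shift_in xD.
  by move=> out; apply: shift_out out (row rxy cxy).
move=> cxy rxy.
have [/andP[xD yD]|] := boolP ((x \in ae_boxes T) && (y \in ae_boxes T)).
  rewrite (shift_col xD yD cxy rxy) (negbTE unb_e) pos'_e.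
  by have /andP[-> _] := pos'_shift_in yD.
by move=> out; apply: shift_out out (col cxy rxy).
Qed.

End OneTableau.

Lemma card_semistandard_swap_le (mu : L -> nat) :
  #|[set T | semistandard r c bar unb pos T && content_eq mu T]| <=
  #|[set T | semistandard r c bar unb pos' T && content_eq mu T]|.
Proof.
rewrite -(@card_in_imset _ _ shift); last first.
  move=> T T'; rewrite !inE => /andP[sT _] /andP[sT' _] eqTT'.
  (* The shifted tableau still shows which boxes hold [a] or [e]; these determine the permutation,
     which can then be undone. *)
  have eqD : ae_boxes T = ae_boxes T'.
    by rewrite -(ae_boxes_shift (rim_ae_boxes sT)) eqTT' ae_boxes_shift //;
       exact: rim_ae_boxes.
  have injs := shift_box_inj (rim_ae_boxes sT).
  apply/ffunP => x; rewrite -[x](f_invF injs).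
  by have := congr1 (fun S : {ffun B -> L} => S (invF injs x)) eqTT';
    rewrite !ffunE -eqD.
apply/subset_leq_card/subsetP => _ /imsetP[T + ->].
rewrite !inE => /andP[sT cT]; rewrite shift_semistandard //=.
by rewrite content_eq_comp //; apply: shift_box_inj; exact: rim_ae_boxes.
Qed.

End Swap.

Lemma card_semistandard_swap r c (bar unb : pred L) pos pos' (a e : L)
    (mu : L -> nat) :
  (forall x y, r x = r y -> c x = c y -> x = y) -> convex_shape r c ->
  injective pos -> injective pos' ->
  unb a -> ~~ bar a -> bar e -> ~~ unb e ->
  pos e = (pos a).+1 -> pos' a = pos e -> pos' e = pos a ->
  (forall l, l != a -> l != e -> pos' l = pos l) ->
  #|[set T | semistandard r c bar unb pos T && content_eq mu T]| =
  #|[set T | semistandard r c bar unb pos' T && content_eq mu T]|.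
Proof.
move=> rc_inj cv pos_inj pos'_inj ua ba be ue pos_e pos'_a pos'_e pos'_id.
apply/eqP; rewrite eqn_leq (@card_semistandard_swap_le r c bar unb pos pos' a
  e) //=.
under eq_finset => T do rewrite -semistandard_tr.
under [X in _ <= #|pred_of_set X|]eq_finset => T do rewrite -semistandard_tr.
have cr_inj x y : c x = c y -> r x = r y -> x = y by move=> *; exact: rc_inj.
(* In the transposed setting [e] is the smaller letter for [pos'] and takes the part of [a]. *)
apply: (@card_semistandard_swap_le c r unb bar pos' pos e a) => //.
- exact: convex_shape_tr.
- by rewrite pos'_a pos'_e.
- by move=> l la le; rewrite pos'_id.
Qed.

End Tableaux.

(** * Positions of a symbol under an adjacent swap *)

Section Positions.
Implicit Types (b u v : seq symbol) (s x y : symbol).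

Definition swap_pos p q := if q == p then p.+1 else if q == p.+1 then p else q.

Lemma size_positions s b : size (positions s b) = count_mem s b.
Proof.
rewrite /positions size_filter -[in RHS](mkseq_nth delta b) /mkseq count_map.
exact: eq_count.
Qed.

Lemma positions_cat s u v :
  positions s (u ++ v) = positions s u ++ map (addn (size u)) (positions s v).
Proof.
rewrite /positions size_cat iotaD filter_cat add0n; congr (_ ++ _).
  apply: eq_in_filter => p; rewrite mem_iota add0n => /andP[_ lt].
  by rewrite nth_cat lt.
rewrite -[X in iota X _]addn0 iotaDl filter_map; congr map.
by apply: eq_filter => p /=; rewrite nth_cat ltnNge leq_addr /= addKn.
Qed.

Lemma mem_positions s b p :
  (p \in positions s b) = (p < size b) && (nth delta b p == s).
Proof. by rewrite mem_filter mem_iota andbC. Qed.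

Lemma positions_lt s b p : p \in positions s b -> p < size b.
Proof. by rewrite mem_filter mem_iota => /and3P[]. Qed.

Lemma positions_cons s x b :
  positions s (x :: b) =
  (if x == s then [:: 0] else [::]) ++ map succn (positions s b).
Proof. by rewrite -cat1s positions_cat /positions /=; case: eqP. Qed.

(** As [x] and [y] differ, [s] occupies at most one of the two swapped places, so renumbering keeps
    the list increasing and the ranks of the letters unchanged. *)
Lemma positions_swap s x y u v : x != y ->
  positions s (u ++ y :: x :: v) =
  map (swap_pos (size u)) (positions s (u ++ x :: y :: v)).
Proof.
move=> xy; rewrite !positions_cat !positions_cons !map_cat -!map_comp.
congr (_ ++ _).
  rewrite -[LHS]map_id; apply/eq_in_map => p /positions_lt lt /=.
  by rewrite /swap_pos; do 2?case: eqP; lia.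
rewrite !catA; congr (_ ++ _).
  by move: xy; case: x; case: y; case: s => //= _;
    rewrite /swap_pos addn0 addn1 ?eqxx //;
    case: eqP => //; lia.
by apply: eq_map => p /=; rewrite /swap_pos; do 2?case: eqP; lia.
Qed.

Lemma nth_positions s b i :
  i < count_mem s b -> nth delta b (nth (size b) (positions s b) i) = s.
Proof.
move=> lt; apply/eqP.
have : nth (size b) (positions s b) i \in positions s b.
  by rewrite mem_nth // size_positions.
by rewrite mem_filter => /andP[].
Qed.

Lemma positions_uniq s b : uniq (positions s b).
Proof. by rewrite filter_uniq ?iota_uniq. Qed.

End Positions.

(** * Letters and their positions *)

Section Letters.
Variables m n : nat.
Implicit Types (b u v : seq symbol) (l : letter m n).

(** Letters of one kind have distinct positions because the list has no repetition; those of
    different kinds, because the sequence has different symbols there. *)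
Lemma letter_pos_inj b : is_eps_delta_seq m n b ->
  injective (@letter_pos m n b).
Proof.
case/andP=> /eqP cd /eqP ce [i|i] [j|j] /= eqij.
- congr inl; apply/val_inj/eqP.
  by rewrite -(nth_uniq (size b) _ _ (positions_uniq delta b)) ?eqij
    ?size_positions ?cd ?ce ?ltn_ord.
- have := @nth_positions delta b i; rewrite cd => /(_ (ltn_ord i)).
  by rewrite eqij nth_positions ?ce.
- have := @nth_positions delta b j; rewrite cd => /(_ (ltn_ord j)).
  by rewrite -eqij nth_positions ?ce.
- congr inr; apply/val_inj/eqP.
  by rewrite -(nth_uniq (size b) _ _ (positions_uniq epsilon b)) ?eqij
    ?size_positions ?cd ?ce ?ltn_ord.
Qed.

Lemma letter_pos_swap u v x y l : x != y ->
  is_eps_delta_seq m n (u ++ x :: y :: v) ->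
  letter_pos (u ++ y :: x :: v) l =
  swap_pos (size u) (letter_pos (u ++ x :: y :: v) l).
Proof.
move=> xy /andP[/eqP cd /eqP ce].
case: l => i /=;
  rewrite (positions_swap _ _ _ xy) (nth_map (size (u ++ x :: y :: v))) //;
  by rewrite size_positions ?cd ?ce.
Qed.

Lemma letter_at_delta b p : is_eps_delta_seq m n b -> p \in positions delta b ->
  exists i : 'I_m, letter_pos b (inl i : letter m n) = p.
Proof.
case/andP=> /eqP cd _ pb; have lt : index p (positions delta b) < m.
  by rewrite -cd -size_positions index_mem.
by exists (Ordinal lt); rewrite /= nth_index.
Qed.

Lemma letter_at_epsilon b p : is_eps_delta_seq m n b ->
  p \in positions epsilon b ->
  exists j : 'I_n, letter_pos b (inr j : letter m n) = p.
Proof.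
case/andP=> _ /eqP ce pb; have lt : index p (positions epsilon b) < n.
  by rewrite -ce -size_positions index_mem.
by exists (Ordinal lt); rewrite /= nth_index.
Qed.

End Letters.

(** * Young diagrams as convex shapes *)

Section Boxes.
Variable la : seq nat.
Hypothesis hla : is_partition la.

Lemma box_inj (x y : box la) : row_of x = row_of y -> col_of x = col_of y ->
  x = y.
Proof.
case: x y => [i j] [i' j']; rewrite /row_of /col_of /= => /val_inj eqi.
by case: _ / eqi j' => j' /val_inj ->.
Qed.

Lemma partition_nth_geq i j : i <= j -> nth 0 la j <= nth 0 la i.
Proof.
move=> ij; case/andP: hla => sorted_la _.
have [jla|jla] := ltnP j (size la); last by rewrite nth_default.
have geq_trans : transitive geq by move=> y x z xy yz; exact: leq_trans yz xy.
rewrite -[_ <= _]/(geq (nth 0 la i) (nth 0 la j)).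
by apply: (sorted_leq_nth geq_trans leqnn 0 sorted_la);
  rewrite ?inE // (leq_ltn_trans ij).
Qed.

Lemma box_convex : convex_shape (@row_of la) (@col_of la).
Proof.
move=> x [i' j'] i j; rewrite /row_of /col_of /= => /andP[_ ii'] /andP[_ jj'].
have ilt : i < size la by exact: leq_ltn_trans ii' (ltn_ord i').
have jlt : j < nth 0 la (Ordinal ilt).
  by apply: leq_ltn_trans jj' (leq_trans (ltn_ord j') _);
    exact: partition_nth_geq.
by exists (Tagged (fun i : 'I_(size la) => 'I_(nth 0 la i)) (Ordinal jlt)).
Qed.

End Boxes.

(** * Super Kostka numbers under one adjacent swap *)

Section Kostka.
Variables (m n : nat) (la : seq nat) (mu : letter m n -> nat).
Hypothesis hla : is_partition la.

Lemma is_semistandardE b (T : filling m n la) :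
  is_semistandard b T =
  semistandard (@row_of la) (@col_of la) (@is_barred m n) (@is_unbarred m n)
    (letter_pos b) T.
Proof.
apply/and4P/andP.
  case=> /'forall_forallP /= H1 /'forall_forallP H2 /'forall_forallP H3
    /'forall_forallP H4; split; apply/increasing_linesP => x y rxy cxy.
    have lxy : left_of x y by rewrite /left_of rxy eqxx.
    split=> [|bx by_]; first by have := H1 x y; rewrite lxy.
    by have := H4 x y; rewrite lxy bx by_.
  have axy : above x y by rewrite /above rxy eqxx.
  split=> [|bx by_]; first by have := H2 x y; rewrite axy.
  by have := H3 x y; rewrite axy bx by_.
case=> /increasing_linesP R /increasing_linesP C.
split; apply/'forall_forallP => x y; apply/implyP.
- by case/andP=> /eqP e l; have [] := R x y e l.
- by case/andP=> /eqP e l; have [] := C x y e l.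
- by case/and3P=> /andP[/eqP e l] ux uy; have [_] := C x y e l; apply.
- by case/and3P=> /andP[/eqP e l] ux uy; have [_] := R x y e l; apply.
Qed.

Lemma super_kostkaE b :
  super_kostka b la mu =
  #|[set T | semistandard (@row_of la) (@col_of la) (@is_barred m n)
               (@is_unbarred m n) (letter_pos b) T && content_eq mu T]|.
Proof. by apply: eq_card => T; rewrite !inE is_semistandardE. Qed.

Lemma super_kostka_swap_delta_epsilon u v :
  is_eps_delta_seq m n (u ++ delta :: epsilon :: v) ->
  is_eps_delta_seq m n (u ++ epsilon :: delta :: v) ->
  super_kostka (u ++ delta :: epsilon :: v) la mu =
  super_kostka (u ++ epsilon :: delta :: v) la mu.
Proof.
move=> hb hb'; have inj := letter_pos_inj hb.
have [i posi] : exists i : 'I_m,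
    letter_pos (u ++ delta :: epsilon :: v) (inl i : letter m n) = size u.
  apply: (letter_at_delta hb).
  by rewrite mem_positions size_cat nth_cat ltnn subnn /= andbT; lia.
have [j posj] : exists j : 'I_n,
    letter_pos (u ++ delta :: epsilon :: v) (inr j : letter m n) = (size u).+1.
  apply: (letter_at_epsilon hb).
  (* Absorbing [delta] into the prefix makes [(size u).+1] the length of that prefix. *)
  by rewrite mem_positions -cat_rcons size_cat nth_cat size_rcons ltnn subnn
    /= andbT; lia.
rewrite !super_kostkaE.
apply: (@card_semistandard_swap _ _ _ _ _ _ _ _ (inl i) (inr j)) => //.
- exact: box_inj.
- exact: box_convex.
- exact: letter_pos_inj.
- by rewrite posi posj.
- by rewrite (letter_pos_swap _ _ hb) // /swap_pos posi posj eqxx.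
- by rewrite (letter_pos_swap _ _ hb) // /swap_pos posi posj eqxx;
    case: eqP => //; lia.
- move=> l; rewrite -!(inj_eq inj) posi posj => li lj.
  by rewrite (letter_pos_swap _ _ hb) // /swap_pos (negbTE li) (negbTE lj).
Qed.

End Kostka.

(** * From adjacent swaps to arbitrary sequences *)

Lemma perm_eq_swap_invariant (S : eqType) (A : Type) (F : seq S -> A) :
  (forall u v x y, F (u ++ x :: y :: v) = F (u ++ y :: x :: v)) ->
  forall s t, perm_eq s t -> F s = F t.
Proof.
move=> swapF.
have move_front u x t1 t2 : F (u ++ t1 ++ x :: t2) = F (u ++ x :: t1 ++ t2).
  elim/last_ind: t1 t2 => [//|t1 y IH] t2.
  by rewrite !cat_rcons -IH !catA swapF.
(* Insertion sort: the head of [s] is brought to the front of [t] and then joins the prefix [u],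
   which must therefore vary in the induction. *)
suff gen s u t : perm_eq s t -> F (u ++ s) = F (u ++ t).
  by move=> s t; exact: (gen s [::]).
elim: s u t => [|x s IH] u t st; first by move: st;
  rewrite perm_sym => /perm_nilP ->.
have xt : x \in t by rewrite -(perm_mem st) mem_head.
case/splitPr: xt st => t1 t2;
  rewrite perm_sym perm_catC /= perm_cons perm_sym => st.
rewrite move_front -cat_rcons -[in RHS]cat_rcons; apply: IH.
by apply: perm_trans st _; rewrite perm_catC.
Qed.

Lemma eps_delta_perm m n b b' :
  is_eps_delta_seq m n b -> is_eps_delta_seq m n b' -> perm_eq b b'.
Proof.
case/andP=> /eqP cd /eqP ce /andP[/eqP cd' /eqP ce'].
by apply/allP => -[] _ /=; rewrite ?cd ?cd' ?ce ?ce'.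
Qed.

Lemma eps_delta_perm_eq m n b b' : perm_eq b b' ->
  is_eps_delta_seq m n b = is_eps_delta_seq m n b'.
Proof. by move=> /permP eqb; rewrite /is_eps_delta_seq !eqb. Qed.

Lemma super_kostka_indep m n la (mu : letter m n -> nat) b b' :
  is_partition la -> is_eps_delta_seq m n b -> is_eps_delta_seq m n b' ->
  super_kostka b la mu = super_kostka b' la mu.
Proof.
move=> hla hb hb'.
(* The swap principle needs a function on all sequences; the value 0 elsewhere is harmless, since a
   swap preserves the symbol counts. *)
pose F s := if is_eps_delta_seq m n s then super_kostka s la mu else 0.
suff : F b = F b' by rewrite /F hb hb'.
apply: perm_eq_swap_invariant (eps_delta_perm hb hb') => u v x y.
have pe : perm_eq (u ++ x :: y :: v) (u ++ y :: x :: v).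
  by rewrite perm_cat2l (perm_catCA [:: x] [:: y]).
rewrite /F -(eps_delta_perm_eq m n pe); case: ifP => // hs.
have hs' := hs; rewrite (eps_delta_perm_eq m n pe) in hs'.
case: x y hs hs' {pe} => [] [] hs hs' //;
  first exact: super_kostka_swap_delta_epsilon.
by apply: esym; exact: super_kostka_swap_delta_epsilon.
Qed.

Theorem corollary3p3p1 (m n : nat) (la : seq nat) (mu : letter m n -> nat)
    (hla : is_hook_partition m n la)
    (hmu : \sum_(a : letter m n) mu a = sumn la) :
  (forall b b' : seq symbol,
     is_eps_delta_seq m n b -> is_eps_delta_seq m n b' ->
     super_kostka b la mu = super_kostka b' la mu) /\
  (exists! K : nat,
     forall b : seq symbol, is_eps_delta_seq m n b -> super_kostka b la mu = K).
Proof.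
have [la_part _] := andP hla; split=> [b b' hb hb'|].
  exact: super_kostka_indep.
(* Any one sequence serves as a witness; its existence also makes [K] unique. *)
pose b0 := nseq m delta ++ nseq n epsilon.
have hb0 : is_eps_delta_seq m n b0.
  by rewrite /is_eps_delta_seq !count_cat !count_nseq /= !mul1n !mul0n addn0
    !eqxx.
exists (super_kostka b0 la mu); split=> [b hb|K]; last exact.
exact: super_kostka_indep.
Qed.
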